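(* Let $n\ge 2$, let $a\in\mathbb{R}^{n+1}\setminus\{0\}$ and define $\lambda:\mathbb{S}^n\to\mathbb{R}$, $\lambda(x)=\langle a,x\rangle$, where $\mathbb{S}^n\subset\mathbb{R}^{n+1}$ is the unit sphere with its canonical metric. Then the vector field $\sigma=\operatorname{grad}^{\mathbb{S}^n}\lambda$ is never a harmonic section (nor a harmonic map) for any Kaluza-Klein metric on $T\mathbb{S}^n$ with $A\equiv1$.
   Context: Let $(M,g)$ be a Riemannian manifold with Levi-Civita connection $\nabla$. At $(p,e)\in TM$ the space $T_{(p,e)}TM$ splits into the vertical space (kernel of $d\pi$, $\pi:TM\to M$ the projection) and the horizontal space defined by $\nabla$; each $X\in T_pM$ has a horizontal lift $X^h$ and a vertical lift $X^v$. A Kaluza-Klein metric on $TM$ is a Riemannian metric $G$ such that at $(p,e)$ $$G(X^h,Y^h)=A(|e|^2)g(X,Y),\quad G(X^h,Y^v)=0,\quad G(X^v,Y^v)=B(|e|^2)g(X,Y)+C(|e|^2)g(X,e)g(Y,e),$$ where $A,B,C$ are real $C^2$ functions on $[0,\infty)$, $A>0$, and $B,C$ are such that $G$ is positive definite. A vector field $\sigma$ on $M$ is viewed as a map $\sigma:(M,g)\to(TM,G)$. Its tension field $\tau(\sigma)=\operatorname{trace}\nabla d\sigma$ (computed with the Levi-Civita connections of $g$ and $G$) is decomposed as $\tau(\sigma)=[\tau^h(\sigma)]^h+[\tau^v(\sigma)]^v$ with $\tau^h(\sigma),\tau^v(\sigma)$ vector fields on $M$. $\sigma$ is a harmonic map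 if $\tau(\sigma)=0$, and a harmonic section if $\tau^v(\sigma)=0$ (equivalently, it is critical for the energy with respect to variations through vector fields). *)

(* Defs.v *)
From HB Require Import structures.
From mathcomp Require Import all_boot all_order all_algebra.
From mathcomp Require Import all_classical all_reals all_analysis.

Set Implicit Arguments.
Unset Strict Implicit.
Unset Printing Implicit Defensive.

Import Order.TTheory GRing.Theory Num.Theory.
Import numFieldNormedType.Exports.

Local Open Scope classical_set_scope.
Local Open Scope ring_scope.

(** * Metrics and tension fields in local coordinates

   Vectors are rows, and a Riemannian metric on an open subset of R^m is given
   by the field [g] of its Gram matrices in the coordinate frame. *)

Definition form (R : realType) (m : nat) (h : 'M[R]_m) (X Y : 'rV[R]_m) : R :=
  (X *m h *m Y^T) 0 0.

(* The norm of the library on ['rV_m] is the sup norm, hence [dot]. *)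
Definition dot (R : realType) (m : nat) (X Y : 'rV[R]_m) : R := form 1%:M X Y.

Definition partial (R : realType) (V : normedModType R) (m : nat) (i : 'I_m)
    (f : 'rV[R]_m -> V) (x : 'rV[R]_m) : V :=
  'D_(delta_mx 0 i) f x.

Definition christoffel (R : realType) (m : nat) (g : 'rV[R]_m -> 'M[R]_m)
    (x : 'rV[R]_m) (k i j : 'I_m) : R :=
  2^-1 * \sum_(l < m) invmx (g x) k l *
    (partial i (fun y => g y j l) x + partial j (fun y => g y i l) x
     - partial l (fun y => g y i j) x).

(* Components Gamma^k_(ij) X^i Y^j of the Levi-Civita connection form. *)
Definition connection (R : realType) (m : nat) (g : 'rV[R]_m -> 'M[R]_m)
    (x X Y : 'rV[R]_m) : 'rV[R]_m :=
  \row_k \sum_(i < m) \sum_(j < m) christoffel g x k i j * X 0 i * Y 0 j.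

(* Components of trace (nabla d phi) for phi : (R^m, g) -> (R^k, h):
   g^(ij) (d_i d_j phi - Gamma(g)^l_(ij) d_l phi + Gamma(h) (d_i phi, d_j phi)). *)
Definition tension (R : realType) (m k : nat) (g : 'rV[R]_m -> 'M[R]_m)
    (h : 'rV[R]_k -> 'M[R]_k) (phi : 'rV[R]_m -> 'rV[R]_k) (x : 'rV[R]_m) :
    'rV[R]_k :=
  \sum_(i < m) \sum_(j < m) invmx (g x) i j *:
    (partial i (partial j phi) x
     - \sum_(l < m) christoffel g x l i j *: partial l phi x
     + connection h (phi x) (partial i phi x) (partial j phi x)).

(** * Submanifolds of R^N *)

(* C^k on an open set: C^(k+1) means differentiable with C^k partial
   derivatives. *)
Fixpoint Ck (R : realType) (V : normedModType R) (m k : nat)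
    (U : set 'rV[R]_m) (f : 'rV[R]_m -> V) : Prop :=
  match k with
  | 0 => forall x, U x -> {for x, continuous f}
  | k'.+1 => (forall x, U x -> differentiable f x) /\
             (forall i, Ck k' U (partial i f))
  end.

Definition smooth (R : realType) (V : normedModType R) (m : nat)
    (U : set 'rV[R]_m) (f : 'rV[R]_m -> V) : Prop :=
  forall k, Ck k U f.

(* Local parametrizations of an m-dimensional submanifold [M], i.e. inverses of
   its charts.  An injective immersion between manifolds of the same dimension
   is a diffeomorphism onto an open set, so this need not be required. *)
Record parametrization (R : realType) (m N : nat) (M : set 'rV[R]_N)
    (U : set 'rV[R]_m) (psi : 'rV[R]_m -> 'rV[R]_N) : Prop := {
  param_open : open U;
  param_smooth : smooth U psi;
  param_sub : forall x, U x -> M (psi x);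
  param_inj : {in U &, injective psi};
  param_immersion : forall x, U x -> row_free ('J psi x) }.

(* Coordinate expression of the tensor on the image of [psi] whose value at p
   is the restriction of the bilinear form [h p] to the tangent space at p. *)
Definition pullback (R : realType) (m N : nat) (psi : 'rV[R]_m -> 'rV[R]_N)
    (h : 'rV[R]_N -> 'M[R]_N) (x : 'rV[R]_m) : 'M[R]_m :=
  'J psi x *m h (psi x) *m ('J psi x)^T.

Definition induced_metric (R : realType) (m N : nat)
    (psi : 'rV[R]_m -> 'rV[R]_N) : 'rV[R]_m -> 'M[R]_m :=
  pullback psi (fun=> 1%:M).

(* Components, in the frame (d_1 psi, ..., d_m psi), of the tangent vector
   field [sigma]. *)
Definition components (R : realType) (m N : nat) (psi : 'rV[R]_m -> 'rV[R]_N)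
    (sigma : 'rV[R]_N -> 'rV[R]_N) (x : 'rV[R]_m) : 'rV[R]_m :=
  sigma (psi x) *m pinvmx ('J psi x).

(* [sigma] is tangent to [M] and <sigma, d psi (X)> = d f (d psi (X)). *)
Definition is_gradient (R : realType) (m N : nat) (M : set 'rV[R]_N)
    (f : 'rV[R]_N -> R) (sigma : 'rV[R]_N -> 'rV[R]_N) : Prop :=
  forall (U : set 'rV[R]_m) (psi : 'rV[R]_m -> 'rV[R]_N),
  parametrization M U psi -> forall x, U x ->
    (sigma (psi x) <= 'J psi x)%MS /\
    (forall X, dot (sigma (psi x)) (X *m 'J psi x) = 'D_X (f \o psi) x).

(** * The tangent bundle

   TM is the set of pairs (p, e) with p in M and e tangent to M at p; it is a
   submanifold of R^(N + N), with the local parametrizations [bundle_param psi].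
   Below, (x, y) are the corresponding coordinates on TM. *)

Definition bundle_param (R : realType) (m N : nat)
    (psi : 'rV[R]_m -> 'rV[R]_N) (z : 'rV[R]_(m + m)) : 'rV[R]_(N + N) :=
  row_mx (psi (lsubmx z)) (rsubmx z *m 'J psi (lsubmx z)).

Definition hlift (R : realType) (m : nat) (g : 'rV[R]_m -> 'M[R]_m)
    (x y X : 'rV[R]_m) : 'rV[R]_(m + m) :=
  row_mx X (- connection g x X y).

Definition vlift (R : realType) (m : nat) (X : 'rV[R]_m) : 'rV[R]_(m + m) :=
  row_mx 0 X.

Definition hpart (R : realType) (m : nat) (w : 'rV[R]_(m + m)) : 'rV[R]_m :=
  lsubmx w.

Definition vpart (R : realType) (m : nat) (g : 'rV[R]_m -> 'M[R]_m)
    (x y : 'rV[R]_m) (w : 'rV[R]_(m + m)) : 'rV[R]_m :=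
  rsubmx w + connection g x (lsubmx w) y.

Lemma hlift_vlift_decomposition (R : realType) (m : nat)
    (g : 'rV[R]_m -> 'M[R]_m) (x y : 'rV[R]_m) (w : 'rV[R]_(m + m))
    (X Y : 'rV[R]_m) :
  w = hlift g x y X + vlift Y <-> X = hpart w /\ Y = vpart g x y w.
Proof.
rewrite /hlift /vlift /hpart /vpart; split=> [->|[-> ->]].
  by rewrite add_row_mx !(row_mxKl, row_mxKr) addr0 addrAC addNr add0r.
by rewrite add_row_mx addr0 addrCA addNr addr0 hsubmxK.
Qed.

(** * Kaluza-Klein metrics *)

(* At [t = 0] this is the right derivative. *)
Definition has_derivative_on_halfline (R : realType) (f f' : R -> R) : Prop :=
  forall t, 0 <= t ->
    (s - t)^-1 * (f s - f t) @[s --> within [set s | 0 <= s] t^'] --> f' t.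

Definition C2_on_halfline (R : realType) (f : R -> R) : Prop :=
  exists f1 f2, [/\ has_derivative_on_halfline f f1,
    has_derivative_on_halfline f1 f2 &
    {within [set s | 0 <= s], continuous f2}].

(* Only the restriction of [G (p, e)] to the tangent space of TM at (p, e) is
   constrained, or used. *)
Record kaluza_klein (R : realType) (m N : nat) (M : set 'rV[R]_N)
    (A B C : R -> R) (G : 'rV[R]_(N + N) -> 'M[R]_(N + N)) : Prop := {
  kk_C2A : C2_on_halfline A;
  kk_C2B : C2_on_halfline B;
  kk_C2C : C2_on_halfline C;
  kk_A_gt0 : forall t, 0 <= t -> 0 < A t;
  kk_sym : forall (U : set 'rV[R]_m) (psi : 'rV[R]_m -> 'rV[R]_N),
    parametrization M U psi -> forall x y, U x -> forall v w,
    form (pullback (bundle_param psi) G (row_mx x y)) v w =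
    form (pullback (bundle_param psi) G (row_mx x y)) w v;
  kk_posdef : forall (U : set 'rV[R]_m) (psi : 'rV[R]_m -> 'rV[R]_N),
    parametrization M U psi -> forall x y, U x -> forall w, w != 0 ->
    0 < form (pullback (bundle_param psi) G (row_mx x y)) w w;
  kk_lifts : forall (U : set 'rV[R]_m) (psi : 'rV[R]_m -> 'rV[R]_N),
    parametrization M U psi -> forall x y, U x -> forall X Y,
    let Gz := form (pullback (bundle_param psi) G (row_mx x y)) in
    let g := induced_metric psi in
    let t := form (g x) y y in
    [/\ Gz (hlift g x y X) (hlift g x y Y) = A t * form (g x) X Y,
        Gz (hlift g x y X) (vlift Y) = 0 &
        Gz (vlift X) (vlift Y) =
          B t * form (g x) X Y + C t * form (g x) X y * form (g x) Y y] }.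

(** * Harmonicity of a vector field, as a map M -> (TM, G) *)

Definition section_tension (R : realType) (m N : nat)
    (G : 'rV[R]_(N + N) -> 'M[R]_(N + N)) (sigma : 'rV[R]_N -> 'rV[R]_N)
    (psi : 'rV[R]_m -> 'rV[R]_N) (x : 'rV[R]_m) : 'rV[R]_(m + m) :=
  tension (induced_metric psi) (pullback (bundle_param psi) G)
    (fun x' => row_mx x' (components psi sigma x')) x.

Definition harmonic_map (R : realType) (m N : nat) (M : set 'rV[R]_N)
    (G : 'rV[R]_(N + N) -> 'M[R]_(N + N)) (sigma : 'rV[R]_N -> 'rV[R]_N) :
    Prop :=
  forall (U : set 'rV[R]_m) (psi : 'rV[R]_m -> 'rV[R]_N),
  parametrization M U psi -> forall x, U x ->
    section_tension G sigma psi x = 0.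

Definition harmonic_section (R : realType) (m N : nat) (M : set 'rV[R]_N)
    (G : 'rV[R]_(N + N) -> 'M[R]_(N + N)) (sigma : 'rV[R]_N -> 'rV[R]_N) :
    Prop :=
  forall (U : set 'rV[R]_m) (psi : 'rV[R]_m -> 'rV[R]_N),
  parametrization M U psi -> forall x, U x ->
    vpart (induced_metric psi) x (components psi sigma x)
      (section_tension G sigma psi x) = 0.

Definition sphere (R : realType) (n : nat) : set 'rV[R]_n.+1 :=
  [set p | dot p p = 1].

(* The dimension [m] of [M] cannot be inferred from the other arguments. *)
Arguments is_gradient {R} m {N} M f sigma.
Arguments kaluza_klein {R} m {N} M A B C G.
Arguments harmonic_map {R} m {N} M G sigma.
Arguments harmonic_section {R} m {N} M G sigma.
Arguments sphere {R} n.

(* Main.v *)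
Require Import Defs.
From HB Require Import structures.
From mathcomp Require Import all_boot all_order all_algebra.
From mathcomp Require Import all_classical all_reals all_analysis.
From mathcomp Require Import ring lra.
(* Again, since the library's [form] shadows the one of [Defs]. *)
Import Defs.
Import Order.TTheory GRing.Theory Num.Theory.
Import numFieldNormedType.Exports.
Local Open Scope classical_set_scope.
Local Open Scope ring_scope.

Set Implicit Arguments.
Unset Strict Implicit.
Unset Printing Implicit Defensive.

(**
   At a unit vector p orthogonal to a the covariant derivative of
   sigma = grad <a, .> vanishes, since nabla_X sigma = - <a, .> X on the sphere.
   As A = 1, the derivatives of B and C then do not contribute to the tension at
   p, and its vertical part is the rough Laplacian of sigma, which is - sigma(p)
   = - a, whatever B and C are.

   This is computed at x = 0 in the stereographic coordinates
   psi(x) = (2u - 1) p + u x E,  u = (1 + |x|^2/4)^-1,  where the rows of E are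
   an orthonormal basis of the orthogonal of p.  The metric is u^2 I, and with
   a = y E the field sigma has the components (1 + |x|^2/4) y - <x, y> x / 2.
   Their second derivatives contribute (m/2 - 1) y to the tension, and each of
   the m coordinate directions contributes - y/2 through the Christoffel symbols
   of G; those are obtained without inverting the vertical block B I + C y^T y,
   because the derivative of the mixed block is - y/2 times that block. *)

(** * Calculus *)

(** Carathéodory's form of the derivative. The explicit derivatives below are all found by
    exhibiting a slope [Phi], which leaves an algebraic identity and continuity at 0 instead of a
    limit. *)
Lemma derive_slope (R : realType) (V W : normedModType R) (f : V -> W)
    (x v : V) (Phi : R -> W) :
  (forall h, f (h *: v + x) = f x + h *: Phi h) -> {for 0, continuous Phi} ->
  'D_v f x = Phi 0.
Proof.
move=> fE Phi0; apply/cvg_lim => //; apply: cvg_trans (_ : Phi @ 0^' --> Phi 0).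
  apply: near_eq_cvg; near=> h.
  rewrite /= fE addrC addKr scalerA mulVf ?scale1r//.
  by near: h; exact: nbhs_dnbhs_neq.
exact: cvg_trans (cvg_fmap2 (@nbhs_dnbhs _ _)) Phi0.
Unshelve. all: by end_near. Qed.

(** * Functions of class C^k *)

Lemma Ck_le (R : realType) (V : normedModType R) m k U (f : 'rV[R]_m -> V) :
  Ck k.+1 U f -> Ck k U f.
Proof.
elim: k f => [|k IHk] f [df pf].
  by move=> x /df /differentiable_continuous.
by split=> // i; exact: IHk.
Qed.

Lemma Ck_cst (R : realType) (V : normedModType R) m k (v : V) :
  Ck k setT (fun=> v : V) (m := m).
Proof.
elim: k v => [|k IHk] v; first by move=> x _; exact: cst_continuous.
split=> [x _|i]; first exact: differentiable_cst.
rewrite (_ : partial i _ = fun=> 0); last first.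
  by apply/funext => x; rewrite /partial derive_cst.
exact: IHk.
Qed.

Lemma Ck_coord (R : realType) m k (j : 'I_m) :
  Ck k setT (fun x : 'rV[R]_m => x 0 j).
Proof.
(* Proving the claim for [k.+1] covers k = 0 without a separate case, since the partial derivatives
   are constant. *)
apply: Ck_le; split=> [x _|i]; first exact: differentiable_coord.
rewrite (_ : partial i _ = fun=> (delta_mx 0 i : 'rV[R]_m) 0 j); last first.
  apply/funext => x; apply: (derive_slope (Phi := fun=> _)) => [h|].
    by rewrite mxE addrC mxE.
  exact: cst_continuous.
exact: Ck_cst.
Qed.

Lemma CkD (R : realType) (V : normedModType R) m k (f g : 'rV[R]_m -> V) :
  Ck k setT f -> Ck k setT g -> Ck k setT (fun x => f x + g x).
Proof.
elim: k f g => [|k IHk] f g.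
  by move=> f0 g0 x Ux; exact: cvgD (f0 x Ux) (g0 x Ux).
move=> [df pf] [dg pg]; split=> [x Ux|i].
  exact: differentiableD (df x Ux) (dg x Ux).
rewrite (_ : partial i _ = fun x => partial i f x + partial i g x); last first.
  apply/funext => x; apply: deriveD; apply: diff_derivable.
    exact: df.
  exact: dg.
exact: IHk (pf i) (pg i).
Qed.

Lemma Ck_sum (R : realType) (V : normedModType R) m k I (r : seq I)
    (f : I -> 'rV[R]_m -> V) :
  (forall i, Ck k setT (f i)) -> Ck k setT (fun x => \sum_(i <- r) f i x).
Proof.
move=> Ckf; elim: r => [|i r IHr].
  by under eq_fun do rewrite big_nil; exact: Ck_cst.
under eq_fun do rewrite big_cons.
exact: CkD.
Qed.

Lemma CkM (R : realType) m k (f g : 'rV[R]_m -> R) :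
  Ck k setT f -> Ck k setT g -> Ck k setT (fun x => f x * g x).
Proof.
elim: k f g => [|k IHk] f g.
  by move=> f0 g0 x Ux; exact: cvgM (f0 x Ux) (g0 x Ux).
move=> Ckf Ckg; have [[df pf] [dg pg]] := (Ckf, Ckg); split=> [x Ux|i].
  exact: differentiableM (df x Ux) (dg x Ux).
rewrite (_ : partial i _ =
    fun x => f x * partial i g x + g x * partial i f x); last first.
  apply/funext => x; apply: deriveM; apply: diff_derivable.
    exact: df.
  exact: dg.
apply: CkD; apply: IHk.
- exact: Ck_le.
- exact: pg.
- exact: Ck_le.
- exact: pf.
Qed.

Lemma CkZl (R : realType) (V : normedModType R) m k (f : 'rV[R]_m -> R)
    (v : V) :
  Ck k setT f -> Ck k setT (fun x => f x *: v).
Proof.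
elim: k f => [|k IHk] f; first by move=> f0 x Ux; exact: cvgZr_tmp (f0 x Ux).
move=> [df pf]; split=> [x Ux|i]; first exact: differentiableZl (df x Ux).
rewrite (_ : partial i _ = fun x => partial i f x *: v); last first.
  apply/funext => x; have dfx : differentiable f x by exact: df.
  rewrite /partial deriveE; last exact: differentiableZl.
  by rewrite diffZl// deriveE.
exact: IHk (pf i).
Qed.

Lemma CkV (R : realType) m k (f : 'rV[R]_m -> R) :
  (forall x, f x != 0) -> Ck k setT f -> Ck k setT (fun x => (f x)^-1).
Proof.
move=> f_neq0; elim: k => [|k IHk].
  by move=> f0 x Ux; exact: cvgV (f_neq0 x) (f0 x Ux).
move=> Ckf; have [df pf] := Ckf; split=> [x Ux|i].
  exact: differentiableV (df x Ux) (f_neq0 x).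
(* The derivative is written with 1/f as a factor, so that [CkM] and the induction hypothesis
   apply. *)
rewrite (_ : partial i _ =
    fun x => ((f x)^-1 * (f x)^-1) * (-1 * partial i f x)); last first.
  apply/funext => x; rewrite /partial deriveV//; last exact/diff_derivable/df.
  by rewrite mulN1r mulrN scaleNr -exprVn expr2.
have CkVf := IHk (Ck_le Ckf).
by apply: CkM; apply: CkM => //; [exact: Ck_cst | exact: pf].
Qed.

(** * The Euclidean inner product *)

Lemma dotE (R : realType) m (X Y : 'rV[R]_m) :
  dot X Y = \sum_(i < m) X 0 i * Y 0 i.
Proof. by rewrite /dot /form mulmx1 mxE; under eq_bigr do rewrite mxE. Qed.

Lemma dotC (R : realType) m (X Y : 'rV[R]_m) : dot X Y = dot Y X.
Proof. by rewrite !dotE; under eq_bigr do rewrite mulrC. Qed.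

Lemma formDl (R : realType) m (h : 'M[R]_m) X Y Z :
  form h (X + Y) Z = form h X Z + form h Y Z.
Proof. by rewrite /form !mulmxDl mxE. Qed.

Lemma formDr (R : realType) m (h : 'M[R]_m) X Y Z :
  form h Z (X + Y) = form h Z X + form h Z Y.
Proof. by rewrite /form linearD mulmxDr mxE. Qed.

Lemma formZl (R : realType) m (h : 'M[R]_m) c X Y :
  form h (c *: X) Y = c * form h X Y.
Proof. by rewrite /form -!scalemxAl mxE. Qed.

Lemma formZr (R : realType) m (h : 'M[R]_m) c X Y :
  form h X (c *: Y) = c * form h X Y.
Proof. by rewrite /form linearZ -scalemxAr mxE. Qed.

Lemma form0l (R : realType) m (h : 'M[R]_m) X : form h 0 X = 0.
Proof. by rewrite /form !mul0mx mxE. Qed.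

Lemma form_delta (R : realType) m (h : 'M[R]_m) i j :
  form h (delta_mx 0 i) (delta_mx 0 j) = h i j.
Proof. by rewrite /form -rowE trmx_delta -colE !mxE. Qed.

Lemma form_scalar (R : realType) m (c : R) (X Y : 'rV[R]_m) :
  form c%:M X Y = c * dot X Y.
Proof. by rewrite /dot /form mul_mx_scalar mulmx1 -scalemxAl mxE. Qed.

Lemma dotDl (R : realType) m (X Y Z : 'rV[R]_m) :
  dot (X + Y) Z = dot X Z + dot Y Z.
Proof. exact: formDl. Qed.

Lemma dotDr (R : realType) m (X Y Z : 'rV[R]_m) :
  dot Z (X + Y) = dot Z X + dot Z Y.
Proof. exact: formDr. Qed.

Lemma dotZl (R : realType) m c (X Y : 'rV[R]_m) : dot (c *: X) Y = c * dot X Y.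
Proof. exact: formZl. Qed.

Lemma dotZr (R : realType) m c (X Y : 'rV[R]_m) : dot X (c *: Y) = c * dot X Y.
Proof. exact: formZr. Qed.

Lemma dot0l (R : realType) m (X : 'rV[R]_m) : dot 0 X = 0.
Proof. exact: form0l. Qed.

Lemma dot_delta (R : realType) m (X : 'rV[R]_m) i :
  dot X (delta_mx 0 i) = X 0 i.
Proof. by rewrite /dot /form mulmx1 trmx_delta -colE mxE. Qed.

Lemma mulmx_tr (R : realType) m (X Y : 'rV[R]_m) : X *m Y^T = (dot X Y)%:M.
Proof. by rewrite [LHS]mx11_scalar /dot /form mulmx1. Qed.

Lemma dot_mulmx (R : realType) m k (X : 'rV[R]_m) (Y : 'rV[R]_k)
    (E : 'M[R]_(m, k)) :
  dot (X *m E) Y = dot X (Y *m E^T).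
Proof. by rewrite /dot /form !mulmx1 trmx_mul trmxK mulmxA. Qed.

Lemma dot_ge0 (R : realType) m (X : 'rV[R]_m) : 0 <= dot X X.
Proof. by rewrite dotE sumr_ge0// => i _; rewrite -expr2 sqr_ge0. Qed.

Lemma dot_eq0 (R : realType) m (X : 'rV[R]_m) : (dot X X == 0) = (X == 0).
Proof.
apply/eqP/eqP=> [|->]; last exact: dot0l.
rewrite dotE => /eqP; rewrite psumr_eq0 => [|i _]; last first.
  by rewrite -expr2 sqr_ge0.
move=> /allP X0; apply/rowP => i; apply/eqP; rewrite mxE.
by have := X0 i (mem_index_enum i); rewrite /= mulf_eq0 orbb.
Qed.

Lemma dot_line (R : realType) m (x v : 'rV[R]_m) (h : R) :
  dot (h *: v + x) (h *: v + x) = dot x x + h * (2 * dot x v + h * dot v v).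
Proof. rewrite !(dotDl, dotDr, dotZl, dotZr) (dotC v x); ring. Qed.

(** * Stereographic coordinates on the sphere *)

Definition conformal_factor (R : realType) m (x : 'rV[R]_m) : R :=
  (1 + dot x x / 4)^-1.

(** Inverse stereographic projection from -p: in the form -p + u (2p + x E), this is the second
    intersection of the sphere with the line from -p through the point p + x E of the tangent
    hyperplane at p. *)
Definition stereo (R : realType) m N (p : 'rV[R]_N) (E : 'M[R]_(m, N))
    (x : 'rV[R]_m) : 'rV[R]_N :=
  (2 * conformal_factor x - 1) *: p + conformal_factor x *: (x *m E).

Lemma conformal_denom_gt0 (R : realType) m (x : 'rV[R]_m) : 0 < 1 + dot x x / 4.
Proof. by rewrite ltr_pwDl// divr_ge0// dot_ge0. Qed.

Lemma conformal_factor_neq0 (R : realType) m (x : 'rV[R]_m) :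
  conformal_factor x != 0.
Proof. by rewrite invr_eq0 gt_eqF// conformal_denom_gt0. Qed.

Lemma conformal_factor0 (R : realType) m : conformal_factor (0 : 'rV[R]_m) = 1.
Proof. by rewrite /conformal_factor dot0l mul0r addr0 invr1. Qed.

(** The relation between u and |x|^2 that is handed to [ring] and [field] when products of u and x
    have to be simplified. *)
Lemma dot_conformal (R : realType) m (x : 'rV[R]_m) :
  conformal_factor x * dot x x = 4 * (1 - conformal_factor x).
Proof.
have := conformal_denom_gt0 x; rewrite /conformal_factor => /lt0r_neq0 d0.
by field; apply: contra d0 => /eqP d0; apply/eqP; lra.
Qed.

Lemma Ck_conformal_factor (R : realType) m k :
  Ck k setT (@conformal_factor R m).
Proof.
apply: CkV => [x|]; first by rewrite gt_eqF// conformal_denom_gt0.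
under eq_fun do rewrite dotE mulr_suml.
apply: CkD; first exact: Ck_cst.
apply: Ck_sum => i; apply: CkM; last exact: Ck_cst.
by apply: CkM; exact: Ck_coord.
Qed.

Lemma smooth_stereo (R : realType) m N (p : 'rV[R]_N) (E : 'M[R]_(m, N)) :
  smooth setT (stereo p E).
Proof.
move=> k; apply: CkD.
  apply: CkZl; apply: CkD; last exact: Ck_cst.
  by apply: CkM; [exact: Ck_cst | exact: Ck_conformal_factor].
under eq_fun do rewrite mulmx_sum_row scaler_sumr.
apply: Ck_sum => i; under eq_fun do rewrite scalerA.
by apply: CkZl; apply: CkM; [exact: Ck_conformal_factor | exact: Ck_coord].
Qed.

Lemma continuous_line (R : realType) m (f : 'rV[R]_m -> R) (x v : 'rV[R]_m) :
  Ck 0 setT f -> {for 0, continuous (fun h : R => f (h *: v + x))}.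
Proof.
move=> f0; apply: (@continuous_comp _ _ _ (fun h : R => h *: v + x)).
  by apply: cvgD; [exact: scalel_continuous | exact: cst_continuous].
exact: f0.
Qed.

(** The difference quotient of u along x + h v after cancelling h, hence meaningful at h = 0, where
    it equals - (u^2/2) <x, v>. *)
Definition conformal_slope (R : realType) m (x v : 'rV[R]_m) (h : R) : R :=
  - (conformal_factor x / 4)
  * (conformal_factor (h *: v + x) * (2 * dot x v + h * dot v v)).

Lemma conformal_factor_line (R : realType) m (x v : 'rV[R]_m) (h : R) :
  conformal_factor (h *: v + x) =
  conformal_factor x + h * conformal_slope x v h.
Proof.
rewrite /conformal_slope.
have := conformal_denom_gt0 x; have := conformal_denom_gt0 (h *: v + x).
rewrite /conformal_factor dot_line => /lt0r_neq0 d1 /lt0r_neq0 d0.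
field; apply/andP; split; [apply: contra d0|apply: contra d1] => /eqP d2.
  by apply/eqP; lra.
by apply/eqP; lra.
Qed.

Lemma continuous_conformal_slope (R : realType) m (x v : 'rV[R]_m) :
  {for 0, continuous (conformal_slope x v)}.
Proof.
apply: continuousM; first exact: cst_continuous.
apply: continuousM; first exact/continuous_line/Ck_conformal_factor.
apply: continuousD; first exact: cst_continuous.
by apply: continuousM; [exact: cvg_id | exact: cst_continuous].
Qed.

Lemma derive_stereo (R : realType) m N (p : 'rV[R]_N) (E : 'M[R]_(m, N)) x v :
  'D_v (stereo p E) x = v *m
    (conformal_factor x *: E
     - (conformal_factor x ^+ 2 / 2) *: (x^T *m (2 *: p + x *m E))).
Proof.
(* Product rule for - p + u (2p + x E): the slope of u times the old vector, plus the new u times v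
   E. *)
rewrite (derive_slope (Phi := fun h =>
    conformal_slope x v h *: (2 *: p + x *m E)
    + conformal_factor (h *: v + x) *: (v *m E))) => [|h|].
- rewrite /conformal_slope mul0r addr0 scale0r add0r mulmxBr -!scalemxAr.
  rewrite mulmxA mulmx_tr mul_scalar_mx scalerA (dotC v) addrC -[in RHS]scaleNr.
  by congr (_ + _ *: _); field.
- rewrite /stereo mulmxDl -scalemxAl.
  move: (conformal_factor_line x v h) (x *m E) (v *m E) => + X Y.
  move: (conformal_slope x v h) => s.
  move: (conformal_factor _) (conformal_factor _) => c' c ->.
  by apply/rowP => j; rewrite !mxE; ring.
- apply: continuousD; apply: continuousZ.
  + exact: continuous_conformal_slope.
  + exact: cst_continuous.
  + exact/continuous_line/Ck_conformal_factor.
  + exact: cst_continuous.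
Qed.

(** * The round metric and the gradient field in coordinates *)

Definition round_metric (R : realType) m (x : 'rV[R]_m) : 'M[R]_m :=
  (conformal_factor x ^+ 2)%:M.

(* [col_mx p E] is an orthogonal matrix. *)
Record adapted_frame (R : realType) m N (p : 'rV[R]_N) (E : 'M[R]_(m, N)) :
    Prop := {
  frame_unit : dot p p = 1;
  frame_orthonormal : E *m E^T = 1%:M;
  frame_normal : E *m p^T = 0;
  frame_complete : p^T *m p + E^T *m E = 1%:M }.

Lemma frame_normal_tr (R : realType) m N (p : 'rV[R]_N) (E : 'M[R]_(m, N)) :
  adapted_frame p E -> p *m E^T = 0.
Proof.
by move=> fr; rewrite -[LHS]trmxK trmx_mul trmxK (frame_normal fr) trmx0.
Qed.

Lemma dot_frame (R : realType) m N (p : 'rV[R]_N) (E : 'M[R]_(m, N)) x y :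
  adapted_frame p E -> dot (x *m E) (y *m E) = dot x y.
Proof.
by move=> fr; rewrite dot_mulmx -mulmxA (frame_orthonormal fr) mulmx1.
Qed.

Lemma dot_normal (R : realType) m N (p : 'rV[R]_N) (E : 'M[R]_(m, N)) x :
  adapted_frame p E -> dot p (x *m E) = 0.
Proof.
by move=> fr; rewrite dotC dot_mulmx (frame_normal_tr fr) dotC dot0l.
Qed.

Lemma jacobian_stereo (R : realType) m N (p : 'rV[R]_N) (E : 'M[R]_(m, N)) x :
  'J (stereo p E) x = conformal_factor x *: E
     - (conformal_factor x ^+ 2 / 2) *: (x^T *m (2 *: p + x *m E)).
Proof.
apply/row_matrixP => i; rewrite !rowE -derive_stereo -deriveEjacobian//.
by have [df _] := smooth_stereo p E 1; exact: df.
Qed.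

(** With W = 2p + x E the Jacobian is u E - (u^2/2) x^T W, where E W^T = x^T and W W^T = 4 + |x|^2 =
    4/u. The cross terms contribute - u^3 x^T x and the square of the second term + u^3 x^T x, so
    only u^2 I remains. *)
Lemma induced_metric_stereo (R : realType) m N (p : 'rV[R]_N)
    (E : 'M[R]_(m, N)) :
  adapted_frame p E -> induced_metric (stereo p E) = round_metric (m := m).
Proof.
move=> fr; apply/funext => x; rewrite /induced_metric /pullback mulmx1.
rewrite jacobian_stereo; set W := 2 *: p + _; set c := conformal_factor x.
have EW : E *m W^T = x^T.
  rewrite linearD linearZ /= mulmxDr -scalemxAr (frame_normal fr) scaler0 add0r.
  by rewrite trmx_mul mulmxA (frame_orthonormal fr) mul1mx.
have WE : W *m E^T = x by rewrite -[LHS]trmxK trmx_mul trmxK EW trmxK.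
have WW : W *m W^T = (4 + dot x x)%:M.
  rewrite mulmx_tr !(dotDl, dotDr, dotZl, dotZr) (frame_unit fr).
  by rewrite (dotC _ p) (dot_normal _ fr) (dot_frame _ _ fr); congr _%:M; ring.
have WxWx : x^T *m W *m (W^T *m x) = (4 + dot x x) *: (x^T *m x).
  by rewrite mulmxA -(mulmxA x^T) WW mul_mx_scalar -scalemxAl.
clearbody W; rewrite linearB !linearZ /= trmx_mul trmxK mulmxDl !mulmxDr.
rewrite -!scalemxAl -!scalemxAr.
rewrite !(mulNmx, mulmxN) WxWx (frame_orthonormal fr) mulmxA EW -mulmxA WE.
move: (x^T *m x) (dot_conformal x) => X cx; rewrite /round_metric -/c in cx *.
apply/matrixP => i j; rewrite !mxE -[RHS]mulr_natr.
by field: cx.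
Qed.

Lemma derive_round_metric (R : realType) m (x v : 'rV[R]_m) i j :
  'D_v (fun y => round_metric y i j) x =
  - (conformal_factor x ^+ 3 * dot x v) * (i == j)%:R.
Proof.
under eq_fun do rewrite mxE -mulr_natr.
rewrite (derive_slope (Phi := fun h => (conformal_slope x v h
    * (conformal_factor (h *: v + x) + conformal_factor x))
    * (i == j)%:R)) => [|h|].
- by rewrite /conformal_slope mul0r addr0 scale0r add0r; field.
- rewrite -[_ + h *: _]/(_ + h * _) mulrA -mulrDl; congr (_ * _).
  by rewrite conformal_factor_line; ring.
- apply: continuousM; last exact: cst_continuous.
  apply: continuousM; first exact: continuous_conformal_slope.
  apply: continuousD; last exact: cst_continuous.
  exact/continuous_line/Ck_conformal_factor.
Qed.

Lemma sum_scalar_mx (R : realType) m (a : R) (k : 'I_m) (F : 'I_m -> R) :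
  \sum_l a%:M k l * F l = a * F k.
Proof.
rewrite (bigD1 k)//= mxE eqxx mulr1n big1 ?addr0// => l lk.
by rewrite mxE eq_sym (negbTE lk) mul0r.
Qed.

Lemma christoffel_round_metric (R : realType) m (x : 'rV[R]_m) k i j :
  christoffel (@round_metric R m) x k i j =
  - (conformal_factor x / 2) *
    (x 0 i * (j == k)%:R + x 0 j * (i == k)%:R - x 0 k * (i == j)%:R).
Proof.
rewrite /christoffel {1}/round_metric invmx_scalar sum_scalar_mx /partial.
rewrite !derive_round_metric !dot_delta.
by have c_neq0 := conformal_factor_neq0 x; field.
Qed.

(** The formula df(X) Y + df(Y) X - <X, Y> grad f for the conformally flat metric e^(2f) I, with f =
    log u and df(X) = - (u/2) <x, X>. *)
Lemma connection_round_metric (R : realType) m (x X Y : 'rV[R]_m) :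
  connection (@round_metric R m) x X Y =
  - (conformal_factor x / 2) *: (dot x X *: Y + dot x Y *: X - dot X Y *: x).
Proof.
apply/rowP => k; rewrite !mxE.
under eq_bigr => i _ do under eq_bigr => j _ do
  rewrite christoffel_round_metric -!mulrA.
under eq_bigr do rewrite -mulr_sumr.
rewrite -mulr_sumr; congr (_ * _); rewrite !dotE.
transitivity (\sum_i \sum_j (x 0 i * X 0 i * ((j == k)%:R * Y 0 j)
   + (x 0 j * Y 0 j) * ((i == k)%:R * X 0 i)
   - x 0 k * X 0 i * ((j == i)%:R * Y 0 j))).
  apply: eq_bigr => i _; apply: eq_bigr => j _; rewrite (eq_sym i j); ring.
have pick (Z : 'rV[R]_m) i : \sum_j (j == i)%:R * Z 0 j = Z 0 i.
  rewrite (bigD1 i)//= eqxx mul1r big1 ?addr0// => j /negbTE->.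
  by rewrite mul0r.
under eq_bigr do rewrite !big_split /= sumrN -!mulr_sumr -mulr_suml !pick.
rewrite !big_split /= sumrN -mulr_suml -mulr_sumr pick; congr (_ + _ - _).
by rewrite mulr_suml; apply: eq_bigr => i _; ring.
Qed.

Lemma jacobian_stereo_gram (R : realType) m N (p : 'rV[R]_N)
    (E : 'M[R]_(m, N)) x : adapted_frame p E ->
  'J (stereo p E) x *m ('J (stereo p E) x)^T = round_metric x.
Proof.
by move=> /induced_metric_stereo <-; rewrite /induced_metric /pullback mulmx1.
Qed.

(** Injectivity: the component of psi(x) along p gives u, and the one along E gives u x. Immersion:
    the Gram matrix of the Jacobian is u^2 I, which yields a right inverse. *)
Lemma parametrization_stereo (R : realType) m n (p : 'rV[R]_n.+1)
    (E : 'M[R]_(m, n.+1)) :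
  adapted_frame p E -> parametrization (sphere n) setT (stereo p E).
Proof.
move=> fr; split; [exact: openT | exact: smooth_stereo | | |].
- move=> x _; rewrite /sphere /= /stereo !(dotDl, dotDr, dotZl, dotZr).
  rewrite (frame_unit fr) (dotC _ p) (dot_normal _ fr) (dot_frame _ _ fr).
  by ring: (dot_conformal x).
- move=> x y _ _ xy.
  have cE z : dot p (stereo p E z) = 2 * conformal_factor z - 1.
    rewrite !(dotDr, dotZr) (frame_unit fr) (dot_normal _ fr).
    by rewrite mulr0 addr0 mulr1.
  have xE z : stereo p E z *m E^T = conformal_factor z *: z.
    rewrite mulmxDl -!scalemxAl (frame_normal_tr fr) scaler0 add0r -mulmxA.
    by rewrite (frame_orthonormal fr) mulmx1.
  have cxy : conformal_factor x = conformal_factor y.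
    by have := cE x; rewrite xy cE; lra.
  apply: (scalerI (conformal_factor_neq0 x)).
  by rewrite -xE xy xE cxy.
- move=> x _; apply/row_freeP.
  exists (('J (stereo p E) x)^T *m (conformal_factor x ^- 2)%:M).
  rewrite mulmxA (jacobian_stereo_gram x fr).
  by rewrite -scalar_mxM divff// expf_neq0// conformal_factor_neq0.
Qed.

(** In coordinates the potential is u <x, y>. Its gradient for the metric u^2 I is u^-2 times the
    Euclidean one, u y - (u^2/2) <x, y> x. Tangency of [sigma] allows it to be recovered from its
    components. *)
Lemma components_gradient_stereo (R : realType) m n (p : 'rV[R]_n.+1)
    (E : 'M[R]_(m, n.+1)) (y : 'rV[R]_m) sigma x :
  adapted_frame p E ->
  is_gradient m (sphere n) (fun q => dot (y *m E) q) sigma ->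
  components (stereo p E) sigma x =
  (1 + dot x x / 4) *: y - (dot x y / 2) *: x.
Proof.
move=> fr grad.
have [tangent gradE] := grad _ _ (parametrization_stereo fr) x I.
have c0 := conformal_factor_neq0 x.
have compE X :
    conformal_factor x ^+ 2 * dot (components (stereo p E) sigma x) X =
    conformal_factor x * dot y X
    - (conformal_factor x ^+ 2 / 2) * (dot x X * dot x y).
  transitivity ('D_X ((fun q => dot (y *m E) q) \o stereo p E) x).
    rewrite -gradE -{1}(mulmxKpV tangent) -/(components _ _ _) [RHS]dot_mulmx.
    rewrite -[_ *m _ *m _^T]mulmxA (jacobian_stereo_gram x fr).
    by rewrite /round_metric mul_mx_scalar dotZr.
  have psiE z : dot (y *m E) (stereo p E z) = conformal_factor z * dot z y.
    rewrite !(dotDr, dotZr) dotC (dot_normal _ fr) (dot_frame _ _ fr) (dotC y).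
    by rewrite mulr0 add0r.
  rewrite (derive_slope (Phi := fun h => conformal_slope x X h * dot x y
     + conformal_factor (h *: X + x) * dot X y)) => [|h|].
  - by rewrite /conformal_slope mul0r addr0 scale0r add0r (dotC X); field.
  - rewrite /= !psiE dotDl dotZl.
    rewrite -[h *: (conformal_slope x X h * _ + _)]/(h * _).
    by rewrite mulrDr {2}conformal_factor_line; ring.
  - apply: continuousD; apply: continuousM.
    + exact: continuous_conformal_slope.
    + exact: cst_continuous.
    + exact/continuous_line/Ck_conformal_factor.
    + exact: cst_continuous.
apply/rowP => i; have := compE (delta_mx 0 i); rewrite !dot_delta !mxE.
rewrite -[1 + _]invrK -/(conformal_factor x) => H.
by apply: (mulfI (expf_neq0 2 c0)); rewrite H; field.
Qed.

(** Meant for B and C at |y|^2 > 0: there the half-line is a neighbourhood of t, so the limit within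
    it is two-sided. *)
Lemma C2_continuous (R : realType) (f : R -> R) t :
  C2_on_halfline f -> 0 < t -> {for t, continuous f}.
Proof.
move=> [f' [_ [df _ _]]] t0; apply/continuous_withinNx.
pose quot s := (s - t)^-1 * (f s - f t).
have slope : quot s @[s --> t^'] --> f' t.
  apply: cvg_trans (df t (ltW t0)) => P FP.
  change (t^' (fun s => P (quot s))).
  have {FP} : t^' (fun s => 0 <= s -> P (quot s)) by exact: FP.
  move/filterS2; apply; last exact: nbhs_dnbhs (lt_nbhsr t0).
  by move=> s Ps /ltW.
(* A zero term is inserted so that the limit has the shape of f t + (s - t) * quot s. *)
have -> : f t = f t + (t - t) * f' t by rewrite subrr mul0r addr0.
apply: (@cvg_trans _ ((f t + (s - t) * quot s) @[s --> t^'])).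
  apply: near_eq_cvg; near=> s.
  rewrite mulrA divff; first by rewrite mul1r addrC subrK.
  by rewrite subr_eq0; near: s; exact: nbhs_dnbhs_neq.
apply: cvgD; first exact: cvg_cst.
apply: cvgM => //; apply: cvgB; last exact: cvg_cst.
exact: nbhs_dnbhs.
Unshelve. all: by end_near. Qed.

(** * Kaluza-Klein metrics in stereographic coordinates *)

Section KaluzaKlein.
Context (R : realType) (m n : nat) (p : 'rV[R]_n.+1) (E : 'M[R]_(m, n.+1)).
Context (fr : adapted_frame p E).
Context (A B C : R -> R) (G : 'rV[R]_(n.+1 + n.+1) -> 'M[R]_(n.+1 + n.+1)).
Context (G_kk : kaluza_klein m (sphere n) A B C G).
Context (A_eq1 : forall t : R, 0 <= t -> A t = 1).

Local Notation g := (@round_metric R m).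
Local Notation H := (pullback (bundle_param (stereo p E)) G).

Let kk_lifts_stereo (x y X Y : 'rV[R]_m) :
  let c2 := conformal_factor x ^+ 2 in let t := c2 * dot y y in
  [/\ form (H (row_mx x y)) (hlift g x y X) (hlift g x y Y) = c2 * dot X Y,
      form (H (row_mx x y)) (hlift g x y X) (vlift Y) = 0 &
      form (H (row_mx x y)) (vlift X) (vlift Y) =
        B t * (c2 * dot X Y) + C t * (c2 * dot X y) * (c2 * dot y Y)].
Proof.
have := kk_lifts G_kk (parametrization_stereo fr) y I X Y (x := x).
rewrite (induced_metric_stereo fr) /= !form_scalar A_eq1 ?mul1r//.
  by rewrite (dotC Y y).
by rewrite mulr_ge0 ?dot_ge0 ?sqr_ge0.
Qed.

Let sym_stereo (x y : 'rV[R]_m) v w :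
  form (H (row_mx x y)) v w = form (H (row_mx x y)) w v.
Proof. exact: (kk_sym G_kk (parametrization_stereo fr)). Qed.

Let unit_stereo (x y : 'rV[R]_m) : H (row_mx x y) \in unitmx.
Proof.
rewrite -row_free_unit -kermx_eq0.
apply/negPn/negP => /rowV0Pn[w /sub_kermxP wH w0].
have := kk_posdef G_kk (parametrization_stereo fr) (x := x) y I w0.
by rewrite /form wH mul0mx mxE ltxx.
Qed.

(** Away from x = 0 the coordinate vector (X, 0) is not horizontal; its vertical part is what makes
    the mixed block of [H] nonzero. *)
Let row_hlift (x y X : 'rV[R]_m) :
  row_mx X 0 = hlift g x y X + vlift (connection g x X y).
Proof.
apply/hlift_vlift_decomposition.
by rewrite /hpart /vpart row_mxKl row_mxKr add0r.
Qed.

Let connection0 (X Y : 'rV[R]_m) : connection g 0 X Y = 0.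
Proof.
by rewrite connection_round_metric !dot0l !scale0r scaler0 add0r subr0 scaler0.
Qed.

Let form_hh0 (y X Y : 'rV[R]_m) :
  form (H (row_mx 0 y)) (row_mx X 0) (row_mx Y 0) = dot X Y.
Proof.
have [hh _ _] := kk_lifts_stereo 0 y X Y.
move: hh; rewrite /hlift !connection0 oppr0 => ->.
by rewrite conformal_factor0 expr1n mul1r.
Qed.

Let form_hv0 (y X Y : 'rV[R]_m) :
  form (H (row_mx 0 y)) (row_mx X 0) (vlift Y) = 0.
Proof.
have [_ hv _] := kk_lifts_stereo 0 y X Y.
by move: hv; rewrite /hlift !connection0 oppr0.
Qed.

(** On the line x = h e_i the terms <x, y> e_i and <e_i, y> x of the connection cancel, so the
    vertical part of (e_i, 0) is - (h u/2) y. The mixed entry is thus the vertical product of that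
    vector with Y, and h factors out. *)
Let form_hv_line (y Y : 'rV[R]_m) i h (x := h *: delta_mx 0 i : 'rV[R]_m)
    (c := conformal_factor x) (t := c ^+ 2 * dot y y) :
  form (H (row_mx x y)) (row_mx (delta_mx 0 i) 0) (vlift Y) =
  h * (- (c ^+ 3 / 2) * dot y Y * (B t + C t * t)).
Proof.
have [_ hv _] := kk_lifts_stereo x y (delta_mx 0 i) Y.
have [_ _ vv] := kk_lifts_stereo x y (connection g x (delta_mx 0 i) y) Y.
rewrite (row_hlift x y) formDl hv add0r vv.
rewrite (_ : connection _ _ _ _ = (- (h * c / 2)) *: y).
  by rewrite !dotZl -/c -/t /t; ring.
rewrite connection_round_metric -/c /x !dotZl (dotC (delta_mx 0 i) y).
rewrite !dot_delta.
by apply/rowP => j; rewrite !mxE !eqxx /=; ring.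
Qed.

(** Because the entry carries the factor h, its derivative is the value of the cofactor at h = 0,
    reached by continuity of B and C at |y|^2; neither is differentiated. The result is - 1/2 times
    the vertical block applied to y. *)
Let derive_hv (y : 'rV[R]_m) i l : y != 0 ->
  partial (lshift m i) (fun z => H z (lshift m i) (rshift m l)) (row_mx 0 y) =
  - (1 / 2) * y 0 l * (B (dot y y) + C (dot y y) * dot y y).
Proof.
move=> y0; pose c h := conformal_factor (h *: (delta_mx 0 i : 'rV[R]_m) + 0).
have c0 : c 0 = 1 by rewrite /c scale0r addr0 conformal_factor0.
have cC k : {for 0, continuous (fun h => c h ^+ k)}.
  apply: (@continuous_comp _ _ _ c (fun s : R => s ^+ k)); last first.
    exact: exprn_continuous.
  exact/continuous_line/Ck_conformal_factor.
pose t h := c h ^+ 2 * dot y y.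
have t0 : t 0 = dot y y by rewrite /t c0 expr1n mul1r.
have tC : {for 0, continuous t}.
  by apply: continuousM; [exact: cC | exact: cst_continuous].
have comp_t f : C2_on_halfline f -> {for 0, continuous (f \o t)}.
  move=> f2; apply: continuous_comp => //; rewrite t0.
  by apply: C2_continuous => //; rewrite lt_def dot_eq0 y0 dot_ge0.
have HE h :
    H (h *: delta_mx 0 (lshift m i) + row_mx 0 y) (lshift m i) (rshift m l) =
    h * (- (c h ^+ 3 / 2) * y 0 l * (B (t h) + C (t h) * t h)).
  rewrite -form_delta delta_mx_lshift delta_mx_rshift scale_row_mx add_row_mx.
  by rewrite scaler0 add0r addr0 form_hv_line dot_delta /t /c addr0.
rewrite /partial (derive_slope (Phi := fun h =>
   - (c h ^+ 3 / 2) * y 0 l * (B (t h) + C (t h) * t h))) => [|h|].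
- by rewrite c0 t0 expr1n.
- apply: etrans (HE h) _; rewrite -[LHS]add0r; congr (_ + _).
  by rewrite -form_delta delta_mx_lshift delta_mx_rshift form_hv0.
- apply: continuousM.
    apply: continuousM; last exact: cst_continuous.
    by apply: continuousN; apply: continuousM;
      [exact: cC | exact: cst_continuous].
  apply: continuousD; first exact: comp_t (kk_C2B G_kk).
  by apply: continuousM => //; exact: comp_t (kk_C2C G_kk).
Qed.

(** Since A = 1, the horizontal block over x = 0 is the identity for every fibre coordinate, hence
    constant along the fibre. *)
Let derive_hh (y : 'rV[R]_m) i l :
  partial (rshift m l) (fun z => H z (lshift m i) (lshift m i)) (row_mx 0 y)
  = 0.
Proof.
have HE z : H (row_mx 0 z) (lshift m i) (lshift m i) = 1.
  by rewrite -form_delta delta_mx_lshift form_hh0 dot_delta mxE !eqxx.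
rewrite /partial (derive_slope (Phi := fun=> 0)) => [//|h|].
  rewrite scaler0 addr0; apply: etrans (esym (HE y)).
  by rewrite delta_mx_rshift scale_row_mx add_row_mx scaler0 add0r; exact: HE.
exact: cst_continuous.
Qed.

Lemma rsubmx_connection_stereo (y : 'rV[R]_m) i : y != 0 ->
  rsubmx (connection H (row_mx 0 y) (row_mx (delta_mx 0 i) 0)
    (row_mx (delta_mx 0 i) 0)) = - (1 / 2) *: y.
Proof.
move=> y0; set z := row_mx 0 y; set i' := lshift m i.
(* The Christoffel symbols of the first kind, with lower index l. *)
pose c (l : 'I_(m + m)) := 2^-1 * (partial i' (fun z => H z i' l) z
  (* The last term vanishes for vertical l by [derive_hh], leaving the derivative of the mixed
     block. *)
  + partial i' (fun z => H z i' l) z - partial l (fun z => H z i' i') z).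
pose d := row_mx (\row_j c (lshift m j)) (- (1 / 2) *: y).
have dE : H z *m d^T = \col_l c l.
  (* The candidate [d] solves H d = c blockwise: the horizontal block is the identity, and the
     vertical block applied to - y/2 gives [derive_hv]. *)
  apply/matrixP => l o; rewrite (ord1 o) [RHS]mxE.
  transitivity (form (H z) (delta_mx 0 l) d).
    by rewrite /form -mulmxA -rowE [RHS]mxE.
  have -> : d = row_mx (\row_j c (lshift m j)) 0 + vlift (- (1 / 2) *: y).
    by rewrite /vlift add_row_mx addr0 add0r.
  rewrite formDr; case: (splitP l) => j lj.
    have -> : l = lshift m j by exact/val_inj.
    by rewrite delta_mx_lshift form_hh0 form_hv0 addr0 dotC dot_delta mxE.
  have -> : l = rshift m j by exact/val_inj.
  rewrite delta_mx_rshift sym_stereo form_hv0 add0r.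
  have [_ _ ->] := kk_lifts_stereo 0 y (delta_mx 0 j) (- (1 / 2) *: y).
  rewrite conformal_factor0 expr1n !mul1r dotZr (dotC _ y) dotZr dot_delta.
  by rewrite /c derive_hv// derive_hh; field.
have -> :
    connection H z (row_mx (delta_mx 0 i) 0) (row_mx (delta_mx 0 i) 0) = d.
  rewrite -delta_mx_lshift; apply/rowP => k; rewrite mxE.
  (* The index is raised by inverting [H]; in the double sum defining the connection only the pair
     (i', i') survives. *)
  transitivity ((invmx (H z) *m (H z *m d^T)) k 0); last first.
    by rewrite mulKmx ?mxE// unit_stereo.
  rewrite (bigD1 i')//= [X in _ + X]big1 => [|j ji]; last first.
    by rewrite big1// => l _; rewrite mxE /= (negbTE ji) mulr0 mul0r.
  rewrite (bigD1 i')//= [X in _ + X + _]big1 => [|j ji]; last first.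
    by rewrite [X in _ * X]mxE /= (negbTE ji) mulr0.
  rewrite dE !mxE !eqxx !mulr1 !addr0 /christoffel mulr_sumr.
  by apply: eq_bigr => l _; rewrite mxE /c mulrCA.
by rewrite row_mxKr.
Qed.

End KaluzaKlein.

(** * The vertical tension at a zero of the potential *)

Lemma connection0l (R : realType) m (g : 'rV[R]_m -> 'M[R]_m) x Y :
  connection g x 0 Y = 0.
Proof.
apply/rowP => k; rewrite !mxE big1// => i _; rewrite big1// => j _.
by rewrite mxE mulr0 mul0r.
Qed.

(** This makes every harmonic map a harmonic section. *)
Lemma vpart0 (R : realType) m (g : 'rV[R]_m -> 'M[R]_m) x y :
  vpart g x y 0 = 0.
Proof. by rewrite /vpart !linear0 connection0l addr0. Qed.

(** The map x |-> (x, sigma) in bundle coordinates. It is quadratic in x, so its slopes are affine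
    in h and those of its partial derivatives are constant. *)
Definition gradient_section (R : realType) m (y x : 'rV[R]_m) :
    'rV[R]_(m + m) :=
  row_mx x ((1 + dot x x / 4) *: y - (dot x y / 2) *: x).

Lemma partial_gradient_section (R : realType) m (y x : 'rV[R]_m) j :
  partial j (gradient_section y) x =
  row_mx (delta_mx 0 j)
    ((x 0 j / 2) *: y - (y 0 j / 2) *: x - (dot x y / 2) *: delta_mx 0 j).
Proof.
rewrite /partial (derive_slope (Phi := fun h =>
    row_mx (delta_mx 0 j)
      ((x 0 j / 2) *: y - (y 0 j / 2) *: x - (dot x y / 2) *: delta_mx 0 j)
    + h *: row_mx 0 (4^-1 *: y - (y 0 j / 2) *: delta_mx 0 j))) => [|h|].
- by rewrite scale0r addr0.
- rewrite /gradient_section scale_row_mx add_row_mx scale_row_mx add_row_mx.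
  rewrite scaler0 addr0 dot_line dotDl dotZl (dotC (delta_mx 0 j) y) !dot_delta.
  rewrite mxE !eqxx; congr row_mx; first by rewrite addrC.
  by apply/rowP => k; rewrite !mxE /=; field.
- apply: continuousD; first exact: cst_continuous.
  exact: scalel_continuous.
Qed.

Lemma partial2_gradient_section (R : realType) m (y : 'rV[R]_m) i :
  rsubmx (partial i (partial i (gradient_section y)) 0) =
  2^-1 *: y - y 0 i *: delta_mx 0 i.
Proof.
rewrite (funext (fun x => partial_gradient_section y x i)) /partial.
rewrite (derive_slope (Phi := fun=>
  row_mx 0 (2^-1 *: y - y 0 i *: delta_mx 0 i))) => [|h|].
- by rewrite row_mxKr.
- rewrite scale_row_mx add_row_mx scaler0 !addr0 dotZl dot0l dotC dot_delta.
  by congr row_mx; apply/rowP => k; rewrite !mxE !eqxx /=; field.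
- exact: cst_continuous.
Qed.

Lemma vpart_section_tension_stereo (R : realType) m n (p : 'rV[R]_n.+1)
    (E : 'M[R]_(m, n.+1)) (y : 'rV[R]_m) sigma A B C G :
  adapted_frame p E -> y != 0 ->
  is_gradient m (sphere n) (fun q => dot (y *m E) q) sigma ->
  kaluza_klein m (sphere n) A B C G -> (forall t, 0 <= t -> A t = 1) ->
  vpart (induced_metric (stereo p E)) 0 (components (stereo p E) sigma 0)
    (section_tension G sigma (stereo p E) 0) = - y.
Proof.
move=> fr y0 grad G_kk A_eq1.
rewrite /section_tension (induced_metric_stereo fr).
rewrite (_ : (fun x => _) = gradient_section y); last first.
  by apply/funext => x; rewrite (components_gradient_stereo x fr grad).
have chr0 k i j : christoffel (@round_metric R m) 0 k i j = 0.
  by rewrite christoffel_round_metric !mxE !mul0r addr0 subr0 mulr0.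
have dphi i : partial i (gradient_section y) 0 = row_mx (delta_mx 0 i) 0.
  by rewrite partial_gradient_section mxE dot0l !mul0r !scale0r scaler0 !subr0.
have phi0 : gradient_section y 0 = row_mx 0 y.
  by rewrite /gradient_section !dot0l !mul0r scale0r subr0 addr0 scale1r.
rewrite /vpart connection_round_metric dot0l !scale0r add0r.
rewrite scaler0 subr0 dot0l scale0r scaler0 addr0.
rewrite /tension {1}/round_metric conformal_factor0 expr1n invmx1 linear_sum /=.
(* At x = 0 the base metric is I and its Christoffel symbols vanish. In direction i the second
   derivative y/2 - y_i e_i and the connection term - y/2 add up to - y_i e_i. *)
transitivity (\sum_i (- y 0 i *: delta_mx 0 i : 'rV[R]_m)); last first.
  rewrite [in RHS](row_sum_delta y) -sumrN.
  by apply: eq_bigr => i _; rewrite scaleNr.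
apply: eq_bigr => i _.
rewrite (bigD1 i)//= [X in _ + X]big1 => [|j ji]; last first.
  by rewrite mxE eq_sym (negbTE ji) scale0r.
rewrite mxE eqxx scale1r addr0 [X in _ - X]big1 => [|l _]; last first.
  by rewrite chr0 scale0r.
rewrite subr0 linearD /= partial2_gradient_section phi0 !dphi.
rewrite (rsubmx_connection_stereo fr G_kk A_eq1)// addrAC -scalerDl.
rewrite scaleNr [2^-1 + _](_ : _ = 0) ?scale0r ?add0r//.
by field.
Qed.

(** * Choice of the point and the frame, and the theorem *)

Lemma exists_adapted_frame (R : realType) n (p : 'rV[R]_n.+1) :
  dot p p = 1 -> exists E : 'M[R]_(n, n.+1), adapted_frame p E.
Proof.
move=> p1; pose e : 'rV[R]_(1 + n) := delta_mx 0 0.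
(* The Householder reflection exchanging [e] and [p]; when [p = e] the
   convention 1 / 0 = 0 makes it the identity. *)
pose v : 'rV[R]_(1 + n) := e - p; pose k := 2 / dot v v.
pose Q : 'M[R]_(1 + n) := 1%:M - k *: (v^T *m v).
have ee : dot e e = 1 by rewrite dot_delta mxE !eqxx.
have vv : dot v v = 2 * dot e v.
  rewrite /v -(scaleN1r p) !(dotDl, dotDr, dotZl, dotZr) ee p1 (dotC p).
  by ring.
have QT : Q^T = Q by rewrite linearB linearZ /= trmx1 trmx_mul trmxK.
(* With P = v^T v one has Q^2 = 1 - 2k P + k^2 |v|^2 P, so this identity gives Q^2 = 1. *)
have k2 : k * k * dot v v = k + k.
  rewrite /k; have [->|v0] := eqVneq (dot v v) 0; first by rewrite invr0; ring.
  by field.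
have PP : v^T *m v *m (v^T *m v) = dot v v *: (v^T *m v).
  by rewrite mulmxA -(mulmxA v^T) mulmx_tr mul_mx_scalar -scalemxAl.
have QQ : Q *m Q^T = 1%:M.
  rewrite QT /Q; move: (v^T *m v) PP => P PP.
  rewrite mulmxBl !mulmxBr !mul1mx mulmx1 -scalemxAl -scalemxAr PP !scalerA k2.
  by rewrite scalerDl opprB addrK subrK.
have eQ : e *m Q = p.
  rewrite mulmxBr mulmx1 -scalemxAr mulmxA mulmx_tr mul_scalar_mx scalerA.
  have [v0|v0] := eqVneq v 0.
    by rewrite v0 scaler0 subr0; apply/eqP; rewrite -subr_eq0; exact/eqP.
  have -> : k * dot e v = 1.
    rewrite /k vv; field.
    by move: v0; rewrite -dot_eq0 vv mulf_eq0 negb_or => /andP[].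
  by rewrite scale1r /v opprB addrC subrK.
have QE : Q = col_mx p (dsubmx Q).
  rewrite -{1}(vsubmxK Q) -eQ; congr col_mx; apply/rowP => j.
  by rewrite /e -rowE [LHS]mxE [RHS]mxE; congr (Q _ j); exact: val_inj.
(* The first row of Q is p and the others form E: the blocks of Q Q^T = 1 are the orthonormality
   relations, and Q^T Q = 1 is completeness. *)
move: QQ (mulmx1C QQ); rewrite QE; move: (dsubmx Q) => E.
rewrite tr_col_mx mul_col_row mul_row_col => + complete.
by rewrite scalar_mx_block => /eq_block_mx[_ _ pE EE]; exists E; split.
Qed.

(** The matrix a^T has rank at most 1 < n + 1, so its left kernel contains a nonzero vector, which
    is then normalised. *)
Lemma exists_unit_orthogonal (R : realType) n (a : 'rV[R]_n.+1) :
  (0 < n)%N -> exists p : 'rV[R]_n.+1, dot p p = 1 /\ dot a p = 0.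
Proof.
move=> n0; have /rowV0Pn[w wa w0] : kermx a^T != 0.
  rewrite -mxrank_eq0 mxrank_ker -lt0n subn_gt0.
  by rewrite (leq_ltn_trans (rank_leq_col _)).
have ww : 0 < dot w w by rewrite lt_def dot_eq0 w0 dot_ge0.
exists ((Num.sqrt (dot w w))^-1 *: w); rewrite !(dotZl, dotZr); split.
  by rewrite mulrA -invfM -expr2 sqr_sqrtr ?dot_ge0// mulVf// gt_eqF.
move/sub_kermxP: wa; rewrite mulmx_tr => /matrixP/(_ 0 0).
by rewrite !mxE eqxx mulr1n dotC => ->; rewrite mulr0.
Qed.

Theorem proposition6p1 (R : realType) (n : nat) (n_ge2 : (2 <= n)%N)
    (a : 'rV[R]_n.+1) (a_neq0 : a != 0)
    (sigma : 'rV[R]_n.+1 -> 'rV[R]_n.+1)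
    (sigma_grad : is_gradient n (sphere n) (fun x => dot a x) sigma)
    (A B C : R -> R) (G : 'rV[R]_(n.+1 + n.+1) -> 'M[R]_(n.+1 + n.+1))
    (G_kk : kaluza_klein n (sphere n) A B C G)
    (A_eq1 : forall t : R, 0 <= t -> A t = 1) :
  ~ harmonic_section n (sphere n) G sigma /\
  ~ harmonic_map n (sphere n) G sigma.
Proof.
suff not_section : ~ harmonic_section n (sphere n) G sigma.
  split=> // map_harm; apply: not_section => U psi psiP x Ux.
  by rewrite (map_harm U psi psiP x Ux) vpart0.
have [p [p1 ap]] := exists_unit_orthogonal a (ltnW n_ge2).
have [E fr] := exists_adapted_frame p1.
(* The coordinates of a in the frame: as a is orthogonal to p, completeness gives a = y E. *)
pose y := a *m E^T.
have yE : y *m E = a.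
  rewrite -[RHS]mulmx1 -(frame_complete fr) mulmxDr mulmxA mulmx_tr ap.
  by rewrite mul_scalar_mx scale0r add0r mulmxA.
have y0 : y != 0 by apply: contra a_neq0 => /eqP y0; rewrite -yE y0 mul0mx.
rewrite -yE in sigma_grad.
move=> /(_ _ _ (parametrization_stereo fr) 0 I).
rewrite (vpart_section_tension_stereo fr y0 sigma_grad G_kk A_eq1).
by move/eqP; rewrite oppr_eq0 (negbTE y0).
Qed.
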